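(* Let $n\ge1$ be an integer, let $l_{Y,n},u_{X,n},u_{Y,n}$ be positive finite constants, and let $\mathcal{P}$ be the class of all distributions $P$ on $\mathbb{R}^2$ such that, for $(X_{1,n},Y_{1,n})\sim P$, $\mathbb{E}[Y_{1,n}]\ge l_{Y,n}>0$, $\mathbb{E}[X_{1,n}^2]\le u_{X,n}$ and $\mathbb{E}[Y_{1,n}^2]\le u_{Y,n}$; assume $\mathcal{P}$ is non-empty (equivalently $l_{Y,n}^2\le u_{Y,n}$). Let $\underline{\alpha}_n:=\big(1-l_{Y,n}^2/u_{Y,n}\big)^n$. Let $I_n$ be a random set (a function of the sample) that contains $\overline{X}_n/\overline{Y}_n$ almost surely whenever it is defined and that is undefined if $\overline{Y}_n=0$. Then $$\sup_{P\in\mathcal{P}}\mathbb{P}_{P^{\otimes n}}\big(I_n\text{ undefined}\big)\ge\underline{\alpha}_n.$$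
   Context: Under $P^{\otimes n}$, the sample $(X_{i,n},Y_{i,n})_{i=1,\dots,n}$ is i.i.d. with distribution $P$; $\overline{X}_n,\overline{Y}_n$ are the empirical means $n^{-1}\sum_iX_{i,n}$, $n^{-1}\sum_iY_{i,n}$. A confidence set is a measurable map from samples to the disjoint union of the family of closed subsets of $\mathbb{R}$ and the singleton $\{\text{undefined}\}$; the ratio $\overline{X}_n/\overline{Y}_n$ is undefined when $\overline{Y}_n=0$. *)

(* Defs.v *)
From HB Require Import structures.
From mathcomp Require Import all_boot all_order all_algebra.
From mathcomp Require Import all_classical all_reals all_analysis.

Set Implicit Arguments.
Unset Strict Implicit.
Unset Printing Implicit Defensive.

Import Order.TTheory GRing.Theory Num.Theory.
Import numFieldNormedType.Exports.

Local Open Scope classical_set_scope.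
Local Open Scope ring_scope.

Section product_probability.
Context d1 d2 (T1 : measurableType d1) (T2 : measurableType d2) (R : realType).
Variables (P : probability T1 R) (Q : probability T2 R).

Definition product_probability : set (T1 * T2) -> \bar R := (P \x Q)%E.

HB.instance Definition _ := Measure.on product_probability.

Let product_probabilityT : product_probability setT = 1%E.
Proof.
rewrite -setXTT; apply: etrans (product_measure1E P Q measurableT measurableT) _.
apply: etrans (mule1 1%E).
exact: (congr2 _ (probability_setT P) (probability_setT Q)).
Qed.

HB.instance Definition _ :=
  Measure_isProbability.Build _ _ _ product_probability product_probabilityT.

End product_probability.

Section iid.
Context d (T : measurableType d) (R : realType).

Definition cons_sample n (x : T * n.-tuple T) : n.+1.-tuple T :=
  [tuple of x.1 :: x.2].

Let measurable_cons_sample n : measurable_fun setT (@cons_sample n).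
Proof. exact: measurable_cons. Qed.

HB.instance Definition _ n :=
  isMeasurableFun.Build _ _ _ _ (@cons_sample n) (@measurable_cons_sample n).

(* P^{\otimes n}: the pushforward of P \x P^{\otimes (n-1)} under consing *)
Fixpoint iid (P : probability T R) n : probability (n.-tuple T) R :=
  match n with
  | 0 => \d_[tuple]
  | n'.+1 =>
      distribution (product_probability P (iid P n')) (@cons_sample n')
  end.

Lemma iid_box (P : probability T R) n (A : 'I_n -> set T) :
  (forall i, measurable (A i)) ->
  iid P n [set s | forall i, A i (tnth s i)] = (\prod_(i < n) P (A i))%E.
Proof.
elim: n A => [|n IHn] A mA.
  rewrite big_ord0 /= diracE mem_set//= => -[]//.
rewrite big_ord_recl -IHn//.
transitivity ((P \x iid P n)%E
  (A ord0 `*` [set s | forall i, A (lift ord0 i) (tnth s i)])).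
  congr ((P \x iid P n)%E _); apply/seteqP; split => -[x s] /=.
    by move=> H; split => [|i]; [exact: (H ord0)|have := H (lift ord0 i); rewrite tnthS].
  move=> [Hx Hs] i; case: (unliftP ord0 i) => [j|] ->//.
  by rewrite tnthS; exact: Hs.
rewrite product_measure1E//.
rewrite (_ : [set _ | _] =
  \bigcap_(i in [set: 'I_n]) ((@tnth n T ^~ i) @^-1` A (lift ord0 i))).
  apply: fin_bigcap_measurable => [|i _]; first exact: finite_finset.
  by rewrite -[X in measurable X]setTI; exact: measurable_tnth.
by apply/seteqP; split => [s H i _|s H i]; exact: H.
Qed.

End iid.

Section confidence_set.
Context (R : realType).

(* A closed set, or [None] for "undefined" *)
Definition confidence_value : Type := option {F : set R | closed F}.

HB.instance Definition _ := gen_eqMixin confidence_value.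
HB.instance Definition _ := gen_choiceMixin confidence_value.
HB.instance Definition _ := isPointed.Build confidence_value None.

Definition hits (U : set R) : set confidence_value :=
  [set v | if v is Some F then sval F `&` U !=set0 else False].

(* The Effros sigma-algebra on the closed sets, with [None] as an atom *)
Definition effros : set (set confidence_value) :=
  [set hits U | U in open] `|` [set [set None]].

Definition confidence_set d (S : measurableType d) :=
  {mfun S >-> g_sigma_algebraType effros}.

Definition undefined d (S : measurableType d) (I : confidence_set S) : set S :=
  [set s | I s = None].

Definition covers (v : confidence_value) (x : R) : Prop :=
  if v is Some F then sval F x else False.

End confidence_set.

Section ratio.
Context (R : realType).

Definition mean_X n (s : n.-tuple (R * R)) : R :=
  (\sum_(i < n) (tnth s i).1) / n%:R.

Definition mean_Y n (s : n.-tuple (R * R)) : R :=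
  (\sum_(i < n) (tnth s i).2) / n%:R.

Definition moment_class (lY uX uY : R) : set (probability (R * R)%type R) :=
  [set P | [/\ (lY%:E <= 'E_P[snd])%E,
               ('E_P[fun z : R * R => (z.1 ^+ 2)%R] <= uX%:E)%E &
               ('E_P[fun z : R * R => (z.2 ^+ 2)%R] <= uY%:E)%E]].

End ratio.

(* Main.v *)
(** Take [X = 0] and let [Y] be [uY / lY] with probability [lY^2 / uY] and [0]
    otherwise: the moment constraints on [Y] hold with equality, and all the
    [Y_i], hence their mean, vanish with probability [(1 - lY^2 / uY)^n]. *)
Require Import Defs.
From HB Require Import structures.
From mathcomp Require Import all_boot all_order all_algebra.
From mathcomp Require Import all_classical all_reals all_analysis measurable_realfun.
From mathcomp Require Import ring.

Import Order.TTheory GRing.Theory Num.Theory.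
Import numFieldNormedType.Exports.

Local Open Scope classical_set_scope.
Local Open Scope ring_scope.

(** The singleton [[set None]] is itself a generator of [effros]. *)
Lemma measurable_undefined (R : realType) d (S : measurableType d)
    (I : confidence_set R S) : measurable (undefined I).
Proof.
rewrite (_ : undefined I = I @^-1` [set None]) // -[X in measurable X]setTI.
by apply: measurable_funPT => //; apply: sub_sigma_algebra; right.
Qed.

(** Integrating a quadratic upper bound on [Y] gives [lY <= uY / (2 lY) + lY / 2], which rearranges
    to the claim. This makes [lY ^+ 2 / uY] a valid Bernoulli parameter. *)
Lemma moment_class_le (R : realType) (lY uX uY : R) :
  0 < lY -> moment_class lY uX uY !=set0 -> lY ^+ 2 <= uY.
Proof.
move=> lY0 [P [EY _ EY2]].
(* AM-GM: [Y <= Y^2 / (2 lY) + lY / 2] *)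
pose g (z : R * R) : R := (lY *+ 2)^-1 * z.2 ^+ 2 + lY / 2.
have k0 : 0 <= (lY *+ 2)^-1 by rewrite invr_ge0 mulrn_wge0 // ltW.
have l20 : 0 <= lY / 2 by rewrite divr_ge0 // ltW.
have g0 z : 0 <= g z by rewrite addr_ge0 // mulr_ge0 // sqr_ge0.
have Yg (z : R * R) : z.2 <= g z.
  rewrite -subr_ge0 (_ : g z - z.2 = (lY *+ 2)^-1 * (z.2 - lY) ^+ 2).
    by rewrite mulr_ge0 // sqr_ge0.
  by rewrite /g; field; rewrite gt_eqF.
have mg : measurable_fun [set: R * R] (fun z => (g z)%:E).
  apply/measurable_EFinP; apply: measurable_funD => //.
  apply: measurable_funM => //.
  by apply: measurable_funX.
have EYg : ('E_P[snd] <= \int[P]_z (g z)%:E)%E.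
  (* Integrability of [snd] is not established here: the negative part is dropped, and the positive
     part lies below [g] because [g] is nonnegative. *)
  rewrite unlock integralE.
  apply: (@le_trans _ _ (\int[P]_z ((fun z => (z.2)%:E) ^\+ z))%E).
    by rewrite geeDl // oppe_le0 integral_ge0.
  apply: ge0_le_integral => //.
  - by apply: measurable_funepos; apply/measurable_EFinP.
  - by move=> z _; rewrite funeposE ge_max !lee_fin Yg g0.
have Eg : (\int[P]_z (g z)%:E =
    ((lY *+ 2)^-1)%:E * 'E_P[fun z => (z.2 ^+ 2)%R] + (lY / 2)%:E)%E.
  rewrite unlock -(@ge0_integralZl_EFin _ _ _ P) //; last 2 first.
  - by move=> z _; rewrite lee_fin sqr_ge0.
  - by apply/measurable_EFinP; apply: measurable_funX.
  rewrite -[X in (_ + X)%E]mule1 -(probability_setT P).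
  rewrite -(integral_cst P measurableT) -ge0_integralD //.
  - by move=> z _; rewrite -EFinM lee_fin mulr_ge0 // sqr_ge0.
  - by apply: measurable_funeM; apply/measurable_EFinP; apply: measurable_funX.
have : (lY%:E <= ((lY *+ 2)^-1)%:E * uY%:E + (lY / 2)%:E)%E.
  apply: (le_trans EY); apply: (le_trans EYg); rewrite Eg.
  by apply: leeD => //; apply: lee_wpmul2l.
rewrite -EFinM -EFinD lee_fin mulrC -lerBlDr ler_pdivlMr ?mulrn_wgt0 // => h.
(* The left side of [h] is [(lY - lY / 2) * (lY *+ 2)], that is [lY ^+ 2]. *)
by rewrite (le_trans _ h) // le_eqVlt; apply/orP; left; apply/eqP; field.
Qed.

Definition two_point (R : realType) (c : R) (b : bool) : R * R :=
  (0, if b then c else 0).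

Fact measurable_two_point (R : realType) (c : R) :
  measurable_fun setT (two_point R c).
Proof. by []. Qed.

HB.instance Definition _ (R : realType) (c : R) :=
  isMeasurableFun.Build _ _ _ _ (two_point R c) (measurable_two_point R c).

(** As a pushforward from [bool], its expectations reduce to two-term sums. *)
Definition two_point_prob (R : realType) (q c : R) : probability (R * R)%type R :=
  distribution (bernoulli_prob q) (two_point R c).

(** The two parameters solve [q * c = lY] and [q * c ^+ 2 = uY]. *)
Lemma two_point_prob_in_moment_class (R : realType) (lY uX uY : R) :
  0 < lY -> 0 < uX -> 0 < uY -> lY ^+ 2 <= uY ->
  moment_class lY uX uY (two_point_prob R (lY ^+ 2 / uY) (uY / lY)).
Proof.
move=> lY0 uX0 uY0 le_uY; set q := lY ^+ 2 / uY; set c := uY / lY.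
have q01 : 0 <= q <= 1.
  by rewrite divr_ge0 ?sqr_ge0 ?(ltW uY0) //= ler_pdivrMr // mul1r.
have c0 : 0 <= c by rewrite divr_ge0 ?ltW.
have l0 : lY != 0 by rewrite gt_eqF.
have u0 : uY != 0 by rewrite gt_eqF.
have qc : q * c = lY by rewrite /q /c; field; rewrite l0 u0.
have qc2 : q * c ^+ 2 = uY by rewrite /q /c; field; rewrite l0 u0.
split; rewrite unlock.
(* [snd] is signed on [R * R], so this change of variables asks for integrability of the composite;
   the squares below use the nonnegative version. *)
- rewrite integral_distribution.
  + rewrite integral_bernoulli_prob //=; last by case; rewrite lee_fin.
    by rewrite mule0 adde0 -EFinM lee_fin qc.
  + exact/measurable_EFinP.
  + apply/integrableP; split => //.
    by rewrite integral_bernoulli_prob //= normr0 mule0 adde0 ltry.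
- rewrite ge0_integral_distribution.
  + rewrite integral_bernoulli_prob //=.
    by rewrite !expr0n /= !mule0 adde0 lee_fin ltW.
  + by apply/measurable_EFinP; apply: measurable_funX.
  + by move=> z; rewrite lee_fin sqr_ge0.
- rewrite ge0_integral_distribution.
  + rewrite integral_bernoulli_prob //=.
      by rewrite expr0n /= mule0 adde0 -EFinM lee_fin qc2.
    by move=> b; rewrite lee_fin sqr_ge0.
  + by apply/measurable_EFinP; apply: measurable_funX.
  + by move=> z; rewrite lee_fin sqr_ge0.
Qed.

(** Since [c != 0], the second coordinate vanishes exactly at [false]. *)
Lemma two_point_prob_snd0 (R : realType) (q c : R) :
  0 <= q <= 1 -> c != 0 ->
  two_point_prob R q c [set z | z.2 = 0] = (1 - q)%:E.
Proof.
move=> q01 c0.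
transitivity (bernoulli_prob q [set false]).
  congr (bernoulli_prob q _); apply/seteqP; split => -[] //= h.
  by move: c0; rewrite h eqxx.
by rewrite bernoulli_probE // !diracE memNset // mem_set // mule0 add0e mule1.
Qed.

Theorem theorem5p2 (R : realType) (n : nat) (lY uX uY : R)
    (I : confidence_set R (n.-tuple (R * R)%type)) :
  (1 <= n)%N -> 0 < lY -> 0 < uX -> 0 < uY ->
  moment_class lY uX uY !=set0 ->
  (forall P, moment_class lY uX uY P ->
    {ae iid P n, forall s, mean_Y s != 0 -> covers (I s) (mean_X s / mean_Y s)}) ->
  (forall s, mean_Y s = 0 -> I s = None) ->
  (((1 - lY ^+ 2 / uY) ^+ n)%:E <=
    ereal_sup [set iid P n (undefined I) | P in moment_class lY uX uY])%E.
Proof.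
move=> _ lY0 uX0 uY0 ne _ undef.
have le_uY := moment_class_le R lY uX uY lY0 ne.
have q01 : 0 <= lY ^+ 2 / uY <= 1.
  by rewrite divr_ge0 ?sqr_ge0 ?(ltW uY0) //= ler_pdivrMr // mul1r.
set P := two_point_prob R (lY ^+ 2 / uY) (uY / lY).
have inP : moment_class lY uX uY P by exact: two_point_prob_in_moment_class.
have c0 : uY / lY != 0 by rewrite mulf_neq0 ?invr_neq0 ?gt_eqF.
pose A : set (R * R) := [set z | z.2 = 0].
have mA : measurable A.
  rewrite (_ : A = snd @^-1` [set 0]) // -[X in measurable X]setTI.
  exact: measurable_snd.
(* The event that every [Y_i] vanishes is a box, so its probability factorizes by [iid_box]. *)
pose B : set (n.-tuple (R * R)) := [set s | forall i, A (tnth s i)].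
have mB : measurable B.
  rewrite (_ : B = \bigcap_(i in [set: 'I_n]) ((@tnth n _ ^~ i) @^-1` A)).
    apply: fin_bigcap_measurable => [|i _]; first exact: finite_finset.
    by rewrite -[X in measurable X]setTI; exact: measurable_tnth.
  by apply/seteqP; split => [s H i _|s H i]; exact: H.
have PB : iid P n B = ((1 - lY ^+ 2 / uY) ^+ n)%:E.
  rewrite (iid_box P (A := fun=> A)) //.
  under eq_bigr do rewrite (two_point_prob_snd0 R _ _ q01 c0).
  by rewrite prodEFin prodr_const card_ord.
(* On [B] the mean of the [Y_i] is zero, hence [B] is contained in [undefined I]; the law [P] then
   bounds the supremum from below. *)
rewrite -PB; apply: (@le_trans _ _ (iid P n (undefined I))).
  apply: le_measure; rewrite ?inE //; first exact: measurable_undefined.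
  by move=> s Bs; apply: undef; rewrite /mean_Y big1 ?mul0r // => i _; exact: Bs.
by apply: ereal_sup_ubound; exists P.
Qed.
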